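(* For every integer $k\geq 1$, the number of (not necessarily linear) $(k,3^{k-1},2)_3$ MDS codes is $3\cdot 2^{k-1}$.
   Context: A $(k,3^{k-1},2)_3$ MDS code is a subset $C\subseteq\mathbb{F}_3^k$ (not necessarily a linear subspace) with $|C|=3^{k-1}$ and minimal Hamming distance $2$, i.e. any two distinct elements of $C$ differ in at least two coordinates (for $k\geq 2$ the minimum distance is then automatically exactly $2$ by the Singleton bound). For $k=1$ the condition is vacuous, so every one-element subset of $\mathbb{F}_3$ counts as such a code. Codes are counted as subsets of $\mathbb{F}_3^k$, not up to equivalence. *)

(* Defs.v *)
From HB Require Import structures.
From mathcomp Require Import all_boot all_order all_algebra.
Set Implicit Arguments.
Unset Strict Implicit.
Unset Printing Implicit Defensive.

Definition hamming_dist (F : finFieldType) (n : nat) (x y : 'rV[F]_n) : nat :=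
  #|[set i : 'I_n | x ord0 i != y ord0 i]|.

(* Not necessarily linear code of length n and size M in which distinct
   codewords are at distance at least d; the distance condition is vacuous
   for a code with a single word. For n >= 2, M = #|F| ^ n.-1 and d = 2, the
   Singleton bound makes the minimum distance exactly 2. *)
Definition is_code (F : finFieldType) (n M d : nat) (C : {set 'rV[F]_n}) : bool :=
  (#|C| == M) &&
  [forall x in C, forall y in C, (x != y) ==> (d <= hamming_dist x y)].

Definition is_ternary_mds (k : nat) (C : {set 'rV['F_3]_k}) : bool :=
  is_code (3 ^ (k - 1)) 2 C.

(* Main.v *)
Require Import Defs.
From HB Require Import structures.
From mathcomp Require Import all_boot all_order all_algebra.
From mathcomp Require Import ring.

(** The codes turn out to be exactly the affine hyperplanes
    [c + \sum_i a_i x_i = 0] all of whose coefficients [a_i] are nonzero.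

    Everything is read off axis-parallel lines [x + t e_i]. A code of size
    [q ^ n] and distance 2 in [F ^ n.+1] meets each such line at most once, and,
    by counting, it meets each line of direction [e_0] exactly once
    ([mds_lineP]). Let [g x] be the parameter of the meeting point on the line
    through [x]; then the code is the zero set of [g], and [g] is injective on
    every axis-parallel line ([mds_offset]).

    Over [F_3] an injective function of one variable is affine ([F3_inj_affine]),
    so [g] is affine on every axis-parallel line, with a nonzero slope. Two
    parallel such lines that differ by a multiple of [e_j] must have the same
    slope: otherwise the two affine functions agree at some parameter, and there
    [g] takes one value twice on a line of direction [e_j]. Hence the slopes are
    constant and [g] is an affine form ([line_affine_inj]). Since [g] is the
    offset along [e_0], its coefficient at [e_0] is -1.

    Conversely each affine form with nonzero coefficients and coefficient -1 at
    [e_0] defines such a code, and it is recovered from its zero set as the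
    offset along [e_0]. There are 3 choices for the constant term and 2 for each
    of the remaining [k - 1] coefficients. *)

Set Implicit Arguments.
Unset Strict Implicit.
Unset Printing Implicit Defensive.

Import GRing.Theory.
Local Open Scope ring_scope.

Local Notation e_ i := (delta_mx 0 i).

Section Lines.

Variables (F : fieldType) (k : nat).
Implicit Types (x : 'rV[F]_k) (i : 'I_k) (t c : F) (a : {ffun 'I_k -> F}).

Lemma line_coord x i t j : (x + t *: e_ i) 0 j = x 0 j + t *+ (j == i).
Proof. by rewrite !mxE eqxx /= mulr_natr. Qed.

Lemma line_ind (P : 'rV[F]_k -> Prop) :
  P 0 -> (forall x i t, P x -> P (x + t *: e_ i)) -> forall x, P x.
Proof.
move=> P0 PS x; rewrite (row_sum_delta x).
elim: (index_enum _) => [|i r IHr]; first by rewrite big_nil.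
by rewrite big_cons addrC; apply: PS.
Qed.

Definition affine_form a c x := c + \sum_i a i * x 0 i.

Lemma affine_form0 a c : affine_form a c 0 = c.
Proof.
by rewrite /affine_form big1 ?addr0 // => i _; rewrite mxE mulr0.
Qed.

Lemma affine_form_line a c x i t :
  affine_form a c (x + t *: e_ i) = affine_form a c x + t * a i.
Proof.
rewrite /affine_form -addrA; congr (_ + _).
rewrite (bigD1 i) //= [in RHS](bigD1 i) //= line_coord eqxx mulr1n.
rewrite (eq_bigr (fun j => a j * x 0 j)) => [|j /negPf ne_ji].
  by ring.
by rewrite line_coord ne_ji addr0.
Qed.

(** Injectivity is what forces two neighbouring parallel lines to have the same
    slope: affine functions of different slopes agree at some parameter. Without
    it, products of coordinates would be counterexamples. *)
Lemma line_affine_inj (g : 'rV[F]_k -> F) (b : 'I_k -> 'rV[F]_k -> F) :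
  (forall x i, injective (fun t => g (x + t *: e_ i))) ->
  (forall x i t, g (x + t *: e_ i) = g x + t * b i x) ->
  exists a c, g =1 affine_form a c.
Proof.
move=> g_inj g_line.
have b_line i x j s : b i (x + s *: e_ j) = b i x.
  apply/eqP/idPn=> ne_b.
  set y := x + s *: e_ j in ne_b.
  (* the parameter at which the lines through x and y take the same value *)
  set t := (g y - g x) / (b i x - b i y).
  have d_n0 : b i x - b i y != 0 by rewrite subr_eq0 eq_sym.
  have same : g (y + t *: e_ i) = g (x + t *: e_ i).
    rewrite (g_line y) (g_line x i); apply/eqP; rewrite -subr_eq0; apply/eqP.
    have ->: g y + t * b i y - (g x + t * b i x)
           = (g y - g x) - t * (b i x - b i y) by ring.
    by rewrite /t divfK // subrr.
  have s0 : s = 0.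
    apply: (g_inj (x + t *: e_ i) j); rewrite scale0r addr0 -same /y.
    by rewrite addrAC.
  by rewrite /y s0 scale0r addr0 eqxx in ne_b.
have b_const i x : b i x = b i 0.
  by elim/line_ind: x => // x j t <-; apply: b_line.
exists [ffun i => b i 0], (g 0); elim/line_ind => [|x i t IHx].
  by rewrite affine_form0.
by rewrite affine_form_line g_line IHx ffunE b_const.
Qed.

End Lines.

(** Three distinct elements of [F_3] sum to zero, which determines the third
    value of an injection from the other two. *)
Lemma F3_inj_affine (h : 'F_3 -> 'F_3) :
  injective h -> forall t, h t = h 0 + t * (h 1 - h 0).
Proof.
move=> h_inj t.
have third (u v w : 'F_3) : u != v -> u != w -> v != w ->
    w = u + (1 + 1) * (v - u).
  move=> uv uw vw; apply/eqP; move: u v w uv uw vw.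
  by move=> [[|[|[|u]]] ?] [[|[|[|v]]] ?] [[|[|[|w]]] ?].
have ne (s r : 'F_3) : s != r -> h s != h r by rewrite (inj_eq h_inj).
have [->|t0] := eqVneq t 0; first by rewrite mul0r addr0.
have [->|t1] := eqVneq t 1; first by ring.
have -> : t = 1 + 1 by apply/eqP; move: t t0 t1 => [[|[|[|t]]] ?].
by apply: third; apply: ne.
Qed.

Section Codes.

Variables (F : finFieldType) (n : nat).
Implicit Types (C : {set 'rV[F]_n.+1}) (x y : 'rV[F]_n.+1).

(** Two words at distance less than 2 lie on a common axis-parallel line. Given
    that, deleting the coordinate 0 is injective on the code, so the code has
    [q ^ n] words exactly when this projection is onto. *)
Lemma mds_lineP C :
  is_code (#|F| ^ n) 2 C <->
  (forall x i t, x \in C -> x + t *: e_ i \in C -> t = 0) /\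
  (forall x, exists t, x + t *: e_ ord0 \in C).
Proof.
have distP : (forall x i t, x \in C -> x + t *: e_ i \in C -> t = 0) <->
    [forall x in C, forall y in C, (x != y) ==> (2 <= hamming_dist x y)%N].
  split=> [C_line | C_dist x i t Cx Cxt].
    apply/forall_inP=> x Cx; apply/forall_inP=> y Cy.
    apply/implyP; apply: contraNT; rewrite -leqNgt => le1.
    case: (pickP [pred i | x 0 i != y 0 i]) => [i /= ne_i | eq_xy]; last first.
      by apply/eqP/rowP=> i; apply/eqP/negbFE/eq_xy.
    have ey : y = x + (y 0 i - x 0 i) *: e_ i.
      apply/rowP=> j; rewrite line_coord.
      have [->|ne_ji] := eqVneq j i; first by rewrite mulr1n addrC subrK.
      rewrite addr0; apply/esym/eqP; apply: contraNT ne_ji => ne_j.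
      by apply/eqP; apply: (card_le1_eqP le1); rewrite inE.
    have := C_line x i (y 0 i - x 0 i) Cx; rewrite -ey => /(_ Cy) t0.
    by rewrite ey t0 scale0r addr0.
  apply/eqP; apply: contraT => t_n0.
  have := forall_inP (forall_inP C_dist x Cx) _ Cxt.
  rewrite -{1}[x]addr0 (inj_eq (addrI x)) eq_sym scaler_eq0 (negPf t_n0) /=.
  have -> /= : (e_ i : 'rV[F]_n.+1) != 0.
    by apply/eqP=> /rowP/(_ i)/eqP; rewrite !mxE !eqxx oner_eq0.
  rewrite ltnNge; case/negP.
  apply: (@leq_trans #|[set i]|); last by rewrite cards1.
  apply: subset_leq_card.
  apply/subsetP=> j; rewrite !inE line_coord; apply: contraNT => /negPf->.
  by rewrite addr0.
have col'_line x y : col' ord0 x = col' ord0 y ->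
    y = x + (y 0 ord0 - x 0 ord0) *: e_ ord0.
  move=> /rowP exy; apply/rowP=> j; rewrite line_coord.
  case: (unliftP ord0 j) => [j' ->|->]; last by rewrite mulr1n addrC subrK.
  by have := exy j'; rewrite !mxE => ->; rewrite addr0.
have line_col' x t : col' ord0 (x + t *: e_ ord0) = col' ord0 x.
  by apply/rowP=> j; rewrite mxE line_coord addr0 mxE.
have cardP : (forall x i t, x \in C -> x + t *: e_ i \in C -> t = 0) ->
    #|C| = #|col' ord0 @: C|.
  move=> C_line; rewrite card_in_imset // => x y Cx Cy /col'_line ey.
  have t0 : y 0 ord0 - x 0 ord0 = 0 by apply: (C_line x ord0); rewrite -?ey.
  by rewrite ey t0 scale0r addr0.
have cardT : #|[set: 'rV[F]_n]| = (#|F| ^ n)%N by rewrite cardsT card_mx mul1n.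
split=> [/andP[/eqP cardC /distP C_line] | [C_line C_meet]].
  split=> // x; have := cardP C_line; rewrite cardC -cardT => eq_card.
  have : col' ord0 x \in col' ord0 @: C.
    suff /eqP-> : col' ord0 @: C == setT by rewrite inE.
    by rewrite eqEcard subsetT eq_card leqnn.
  by case/imsetP=> y Cy /col'_line ey; exists (y 0 ord0 - x 0 ord0); rewrite -ey.
apply/andP; split; last exact/distP.
rewrite cardP // -cardT; apply/eqP; congr #|pred_of_set _|; apply/setP=> z.
rewrite inE; apply/imsetP.
(* the word of C is sought on the line above z, through its lift by zero *)
have [t Ct] := C_meet (\row_j oapp (z 0) 0 (unlift ord0 j)).
exists (\row_j oapp (z 0) 0 (unlift ord0 j) + t *: e_ ord0) => //.
by rewrite line_col'; apply/rowP=> j; rewrite !mxE liftK.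
Qed.

Lemma mds_offset C : is_code (#|F| ^ n) 2 C ->
  exists g : 'rV[F]_n.+1 -> F,
    [/\ forall x, (x \in C) = (g x == 0),
        forall x i, injective (fun t => g (x + t *: e_ i))
      & forall x t, g (x + t *: e_ ord0) = g x - t].
Proof.
case/mds_lineP=> C_line C_meet.
pose g x := xchoose (C_meet x).
have gC x : x + g x *: e_ ord0 \in C by exact: (xchooseP (C_meet x)).
have g_uniq x t : x + t *: e_ ord0 \in C -> g x = t.
  move=> Ct; apply/eqP; rewrite -subr_eq0; apply/eqP.
  apply: (C_line _ ord0 _ Ct).
  by rewrite -addrA -scalerDl [t + _]addrC subrK gC.
exists g; split=> [x | x i t s eq_g | x t].
- apply/idP/eqP=> [Cx | g0]; first by apply: g_uniq; rewrite scale0r addr0.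
  by have := gC x; rewrite g0 scale0r addr0.
- apply/eqP; rewrite -subr_eq0; apply/eqP.
  apply: (C_line _ i _ (gC (x + s *: e_ i))).
  rewrite addrAC -(addrA x) -scalerDl [s + _]addrC subrK -[g _]eq_g.
  exact: gC.
- apply: g_uniq; rewrite -addrA -scalerDl [t + _]addrC subrK; exact: gC.
Qed.

Definition hyperplane (p : {ffun 'I_n.+1 -> F} * F) : {set 'rV[F]_n.+1} :=
  [set x | affine_form p.1 p.2 x == 0].

(** Proportional forms have the same zero set, so the coefficient at [e_0] is
    fixed. The value -1 makes the form the offset to its zero set along
    [e_0]. *)
Definition normalized : {set {ffun 'I_n.+1 -> F} * F} :=
  setX [set a in family (fun i => if i == ord0 then pred1 (-1) else predC1 0)]
       setT.

Lemma normalizedP (p : {ffun 'I_n.+1 -> F} * F) :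
  reflect (p.1 ord0 = -1 /\ forall i, p.1 i != 0) (p \in normalized).
Proof.
case: p => a c; rewrite in_setX in_set in_setT andbT.
apply: (iffP familyP) => /= [H | [H0 Hn] i].
  have H0 : a ord0 = -1 by apply/eqP; apply: (H ord0).
  split=> // i; have := H i; case: eqP => // -> _.
  by rewrite H0 oppr_eq0 oner_eq0.
by case: eqP => [->|_]; rewrite !inE ?H0 ?eqxx ?Hn.
Qed.

Lemma card_normalized : #|normalized| = (#|F| * #|F|.-1 ^ n)%N.
Proof.
rewrite cardsX cardsT mulnC cardsE card_family; congr muln.
rewrite foldrE big_map big_enum /= big_ord_recl eqxx card1 mul1n.
rewrite (eq_bigr (fun=> #|F|.-1)) ?prod_nat_const ?card_ord // => i _.
by rewrite /= -(cardC1 (0 : F)).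
Qed.

Lemma hyperplane_mds p : p \in normalized -> is_code (#|F| ^ n) 2 (hyperplane p).
Proof.
case/normalizedP=> p0 p_n0; apply/mds_lineP; split=> [x i t | x].
  rewrite !inE affine_form_line => /eqP-> /eqP; rewrite add0r => /eqP.
  by rewrite mulf_eq0 (negPf (p_n0 i)) orbF => /eqP.
exists (affine_form p.1 p.2 x).
by rewrite inE affine_form_line p0 mulrN1 subrr.
Qed.

Lemma hyperplane_inj : {in normalized &, injective hyperplane}.
Proof.
move=> [a c] [b d] /normalizedP[/= a0 _] /normalizedP[/= b0 _] /setP eqH.
have eq_form x : affine_form a c x = affine_form b d x.
  have := eqH (x + affine_form a c x *: e_ ord0).
  rewrite !inE /= !affine_form_line a0 b0 !mulrN1 subrr eqxx.
  by move/esym; rewrite subr_eq0 => /eqP.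
have eq_cd : c = d by have := eq_form 0; rewrite !affine_form0.
congr pair => //; apply/ffunP=> i.
have := eq_form (0 + 1 *: e_ i).
by rewrite !affine_form_line !affine_form0 !mul1r eq_cd => /addrI.
Qed.

End Codes.

(** Injectivity on lines makes every slope of the offset function nonzero, and
    the shift rule along [e_0] makes the leading one -1. *)
Lemma ternary_mds_hyperplane n (C : {set 'rV['F_3]_n.+1}) :
  is_code (#|'F_3| ^ n) 2 C ->
  exists2 p, p \in normalized 'F_3 n & C = hyperplane p.
Proof.
case/mds_offset=> g [gC g_inj g_shift].
have g_line x i t :
    g (x + t *: e_ i) = g x + t * (g (x + 1 *: e_ i) - g x).
  by have := F3_inj_affine (g_inj x i) t; rewrite scale0r addr0.
have [a [c g_form]] :=
  line_affine_inj (b := fun i x => g (x + 1 *: e_ i) - g x) g_inj g_line.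
exists (a, c); last by apply/setP=> x; rewrite inE gC g_form.
apply/normalizedP; split=> /= [|i].
  have := g_shift 0 1; rewrite !g_form affine_form_line mul1r.
  by move/addrI.
apply/eqP=> ai0; have /eqP := oner_neq0 'F_3; case.
by apply: (g_inj 0 i); rewrite !g_form !affine_form_line ai0 !mulr0.
Qed.

Local Close Scope ring_scope.

Theorem theorem4p10 (k : nat) (hk : 1 <= k) :
  #|[set C : {set 'rV['F_3]_k} | is_ternary_mds C]| = 3 * 2 ^ (k - 1).
Proof.
case: k hk => // n _; rewrite subn1 /=.
have cardF3 : #|'F_3| = 3 by rewrite card_Fp.
have -> : [set C : {set 'rV['F_3]_n.+1} | is_ternary_mds C]
        = @hyperplane 'F_3 n @: normalized 'F_3 n.
  apply/setP=> C; rewrite inE /is_ternary_mds subn1 /= -[X in X ^ n]cardF3.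
  apply/idP/imsetP=> [/ternary_mds_hyperplane|[p /hyperplane_mds ? ->]] //.
by rewrite card_in_imset ?card_normalized ?cardF3 //; apply: hyperplane_inj.
Qed.
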